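(* Let $J$ be an $N\times N$ real Jacobi matrix (entries $a_n,b_n\in\mathbb{R}$, $a_n\ne0$) and let $\Omega$ be its generalized spectral function. Then for any $G(\lambda)\in\mathbb{C}_{2N}[\lambda]$ $$\langle\Omega,G(\lambda)\rangle=\sum_{k=1}^{N}\beta_kG(\lambda_k),$$ where $\lambda_1,\dots,\lambda_N$ are the eigenvalues of the matrix $J$ and $\beta_1,\dots,\beta_N$ are positive real numbers uniquely determined by the matrix $J$.
   Context: $N$ is a positive integer. A real Jacobi matrix $J$ here is an $N\times N$ symmetric tridiagonal matrix (rows and columns indexed $0,\dots,N-1$) with diagonal entries $b_0,\dots,b_{N-1}\in\mathbb{R}$, with nonzero entries $a_n\in\mathbb{R}$ in positions $(n,n+1)$ and $(n+1,n)$ for $0\le n\le N-2$, and zeros elsewhere. Such a matrix has precisely $N$ real and distinct eigenvalues. Put $a_{N-1}=1$. The polynomials $P_0(\lambda),\dots,P_N(\lambda)$ associated with $J$ are defined by $P_0(\lambda)=1$, $b_0P_0(\lambda)+a_0P_1(\lambda)=\lambda P_0(\lambda)$, $a_{n-1}P_{n-1}(\lambda)+b_nP_n(\lambda)+a_nP_{n+1}(\lambda)=\lambda P_n(\lambda)$ for $n\in\{1,\dots,N-1\}$. $\mathbb{C}_m[\lambda]$ is the space of polynomials of degree $\le m$ with complex coefficients; $\langle\Omega,G(\lambda)\rangle$ denotes the value of the linear functional $\Omega$ at $G$. The generalized spectral function of $J$ is the unique linear functional $\Omega:\mathbb{C}_{2N}[\lambda]\to\mathbb{C}$ such that $\langle\Omega,P_mP_n\rangle=\delta_{mn}$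 for $m,n\in\{0,\dots,N-1\}$ and $\langle\Omega,P_mP_N\rangle=0$ for $m\in\{0,\dots,N\}$. *)

(* Defs.v *)
From mathcomp Require Import all_boot all_order all_algebra.
From mathcomp Require Import reals complex.

Set Implicit Arguments.
Unset Strict Implicit.
Unset Printing Implicit Defensive.

Import Order.TTheory GRing.Theory Num.Theory.

Local Open Scope ring_scope.
Local Open Scope complex_scope.

Section Jacobi.
Variables (R : realType) (N : nat) (a b : nat -> R).

(* Only a 0, ..., a (N - 2) and b 0, ..., b (N - 1) are ever used: the other
   values of the two sequences are irrelevant. *)
Definition jacobi_mx : 'M[R]_N :=
  \matrix_(i < N, j < N)
    if i == j then b i
    else if (j == i.+1 :> nat) then a i
    else if (i == j.+1 :> nat) then a j
    else 0.

(* The off-diagonal entries extended by the convention a_(N-1) = 1. *)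
Definition ext_offdiag (n : nat) : R := if n.+1 == N then 1 else a n.

(* The three-term relations solved for the polynomial of highest index;
   jacobi_poly_rec0 and jacobi_poly_recS give back the relations themselves. *)
Fixpoint jacobi_poly (n : nat) : {poly R} :=
  if n is m.+1 then
    (ext_offdiag m)^-1 *:
      (('X - (b m)%:P) * jacobi_poly m
       - (if m is k.+1 then ext_offdiag k *: jacobi_poly k else 0))
  else 1.

Definition cjacobi_poly (n : nat) : {poly R[i]} :=
  map_poly (real_complex R) (jacobi_poly n).

(* {poly_(2 * N).+1 R[i]} consists of the polynomials of degree <= 2N. By
   size_cjacobi_polyM the products below have degree <= 2N, so that npolyp,
   which truncates in general, is here a mere change of type. *)
Definition is_generalized_spectral_function
    (Omega : {scalar {poly_(2 * N).+1 R[i]}}) : Prop :=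
  (forall m n, (m < N)%N -> (n < N)%N ->
     Omega (npolyp (2 * N).+1 (cjacobi_poly m * cjacobi_poly n)) = (m == n)%:R)
  /\
  (forall m, (m <= N)%N ->
     Omega (npolyp (2 * N).+1 (cjacobi_poly m * cjacobi_poly N)) = 0).

Hypothesis a_neq0 : forall n, (n.+1 < N)%N -> a n != 0.

Lemma ext_offdiag_neq0 n : (n < N)%N -> ext_offdiag n != 0.
Proof.
rewrite /ext_offdiag leq_eqVlt; case: eqP => [_ _|_ /= /a_neq0 //].
exact: oner_neq0.
Qed.

Lemma jacobi_poly_rec0 : (0 < N)%N ->
  b 0%N *: jacobi_poly 0 + ext_offdiag 0 *: jacobi_poly 1
  = 'X * jacobi_poly 0.
Proof.
move=> N0; rewrite /= scalerKV ?ext_offdiag_neq0 // subr0 !mulr1.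
by rewrite alg_polyC addrC subrK.
Qed.

Lemma jacobi_poly_recS n : (n.+1 < N)%N ->
  ext_offdiag n *: jacobi_poly n + b n.+1 *: jacobi_poly n.+1
    + ext_offdiag n.+1 *: jacobi_poly n.+2 = 'X * jacobi_poly n.+1.
Proof.
move=> nN; rewrite [jacobi_poly n.+2]/= -/(jacobi_poly n.+1).
rewrite scalerKV ?ext_offdiag_neq0 // mulrBl mul_polyC.
by rewrite -[_ - _ *: _ - _]addrA -opprD [b _ *: _ + _]addrC [LHS]addrC subrK.
Qed.

Lemma size_jacobi_poly n : (size (jacobi_poly n) <= n.+1)%N.
Proof.
have [k] := ubnP n; elim: k n => // k IH [|n] nk; first by rewrite size_poly1.
rewrite /= -/(jacobi_poly n) (leq_trans (size_scale_leq _ _)) //.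
rewrite (leq_trans (size_polyD _ _)) // geq_max size_polyN; apply/andP; split.
  by rewrite (leq_trans (size_polyMleq _ _)) // size_XsubC; apply: IH.
case: n nk => [|n] nk; first by rewrite size_poly0.
rewrite (leq_trans (size_scale_leq _ _)) //.
exact: leq_trans (IH n (ltnW nk)) (leqW (leqnSn _)).
Qed.

Lemma size_cjacobi_polyM m n : (m <= N)%N -> (n <= N)%N ->
  (size (cjacobi_poly m * cjacobi_poly n)%R <= (2 * N).+1)%N.
Proof.
move=> mN nN; rewrite -rmorphM /= size_map_poly.
rewrite (leq_trans (size_polyMleq _ _)) // -subn1 leq_subLR.
rewrite (leq_trans (leq_add (size_jacobi_poly m) (size_jacobi_poly n))) //.
by rewrite addSn addnS mul2n -addnn !ltnS leq_add.
Qed.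

End Jacobi.

(* Main.v *)
(* With K_y(X) = \sum_(n < N) P_n(y) P_n(X), the Christoffel-Darboux identity at
   a root z of P_N reads (X - z) K_z(X) = P_(N-1)(z) P_N(X).  As K_z(z^* ) is
   positive, evaluating at z^* shows that z is real; differentiating at z, that
   it is simple; evaluating at another root y, that K_z(y) = 0.  So P_N has N
   distinct real roots, which are the eigenvalues of J, and the matrix with
   entries P_n(lambda_k) has orthogonal columns of squared norms K_k(lambda_k).
   Inverting it gives the orthogonality relations of the P_n for the weights
   beta_k = 1 / K_k(lambda_k), where K_k is the kernel at lambda_k: the
   quadrature with these weights is a generalized spectral function, and such a
   functional is unique because the P_m P_0 and P_m P_N span the polynomials of
   degree <= 2N.  Testing this quadrature on K_k recovers beta_k, so that the
   weights are unique. *)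
Require Import Defs.
From HB Require Import structures.
From mathcomp Require Import all_boot all_order all_algebra all_field ring.
From mathcomp Require Import reals complex.

Set Implicit Arguments.
Unset Strict Implicit.
Unset Printing Implicit Defensive.

Import Order.TTheory GRing.Theory Num.Theory.

Local Open Scope ring_scope.
Local Open Scope complex_scope.

(** * Quadrature sums as linear functionals *)

Section Quadrature.
Variables (K : comNzRingType) (I : finType) (n : nat) (beta x : I -> K).

Definition quadrature (G : {poly_n K}) : K :=
  \sum_k beta k * (G : {poly K}).[x k].

Fact quadrature_is_scalar : scalar quadrature.
Proof.
move=> c G H; rewrite /quadrature mulr_sumr -big_split /=.
by apply: eq_bigr => k _; rewrite hornerD hornerZ mulrDr mulrCA.
Qed.

HB.instance Definition _ :=
  GRing.isLinear.Build K {poly_n K} K *%R quadrature quadrature_is_scalar.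

End Quadrature.

(** * Three-term recurrence and the Christoffel-Darboux identity *)

Section ChristoffelDarboux.
Variables (R : realType) (N : nat) (a b : nat -> R).
Hypothesis a_neq0 : forall n, (n.+1 < N)%N -> a n != 0.

Local Notation A := (ext_offdiag N a).
Local Notation p := (jacobi_poly N a b).
Local Notation P := (cjacobi_poly N a b).

Let A_neq0 n : (n < N)%N -> A n != 0.
Proof. exact: ext_offdiag_neq0. Qed.

Lemma cjacobi_poly_rec n : (n < N)%N ->
  (A n)%:C *: P n.+1 = ('X - (b n)%:C%:P) * P n
    - (if n is k.+1 then (A k)%:C *: P k else 0).
Proof.
move=> nN; rewrite /cjacobi_poly -map_polyZ /= -/(p n) scalerKV ?A_neq0 //.
rewrite rmorphB rmorphM rmorphB /= map_polyX map_polyC /=; congr (_ - _).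
by case: n nN => [|n] _; rewrite ?rmorph0 ?map_polyZ.
Qed.

Lemma cjacobi_poly0 : P 0 = 1. Proof. exact: rmorph1. Qed.

(** Induction on [m]: expand the right side by the recurrence at ['X] and at [y]. The terms in [b]
    cancel, and those in [A m] form the right side at the previous index. *)
Lemma christoffel_darboux y m : (m < N)%N ->
  ('X - y%:P) * (\sum_(n < m.+1) (P n).[y] *: P n) =
  (A m)%:C *: ((P m).[y] *: P m.+1 - (P m.+1).[y] *: P m).
Proof.
elim: m => [|m IH] mN.
  rewrite big_ord1 cjacobi_poly0 scalerBr !scalerA [(A 0)%:C * _]mulrC -!scalerA.
  rewrite cjacobi_poly_rec // cjacobi_poly0 subr0 scalerA -hornerZ.
  rewrite cjacobi_poly_rec // cjacobi_poly0 subr0 !mulr1.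
  rewrite !hornerE !scale1r !alg_polyC mulr1 polyCB.
  by rewrite opprB addrA subrK.
rewrite big_ord_recr mulrDr IH 1?ltnW //=.
rewrite !scalerBr !scalerA [(A m.+1)%:C * _]mulrC -!scalerA.
rewrite cjacobi_poly_rec // [X in _ = _ - X]scalerA -hornerZ cjacobi_poly_rec //.
set Q := P m.+1; set T := P m.
rewrite !hornerE -!mul_polyC !(polyCM, polyCB).
ring.
Qed.

Definition cd_kernel (y : R[i]) : {poly R[i]} := \sum_(n < N) (P n).[y] *: P n.

Lemma horner_cd_kernel x y :
  (cd_kernel y).[x] = \sum_(n < N) (P n).[y] * (P n).[x].
Proof.
by rewrite /cd_kernel horner_sum; apply: eq_bigr => n _; rewrite hornerZ.
Qed.

Lemma horner_cjacobi_real n (x : R) : (P n).[x%:C] = (p n).[x]%:C.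
Proof. by rewrite /cjacobi_poly horner_map. Qed.

Lemma horner_cjacobi_conj n (z : R[i]) : (P n).[z^*%C] = (P n).[z]^*%C.
Proof.
rewrite -horner_map /=; congr (_.[_]).
apply/polyP => i; rewrite !coef_map /=.
by rewrite -conjc_real.
Qed.

(** * Reality and simplicity of the zeros of [P N] *)

Hypothesis N_gt0 : (0 < N)%N.

(** The [P n] have real coefficients, so each term is [P n] at [z] times its conjugate, hence
    nonnegative; the term [n = 0] is 1. *)
Lemma cd_kernel_conj_gt0 z : 0 < (cd_kernel z).[z^*%C].
Proof.
rewrite horner_cd_kernel (bigD1 (Ordinal N_gt0)) //= cjacobi_poly0 !hornerC.
rewrite mulr1 ltr_pwDl ?ltr01 // sumr_ge0 // => n _.
by rewrite horner_cjacobi_conj mulcJ_ge0.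
Qed.

Lemma cd_kernel_real_gt0 (x : R) : 0 < (cd_kernel x%:C).[x%:C].
Proof. by have := cd_kernel_conj_gt0 x%:C; rewrite conjc_real. Qed.

Lemma christoffel_darboux_root z : root (P N) z ->
  ('X - z%:P) * cd_kernel z = (P N.-1).[z] *: P N.
Proof.
move=> /rootP Pz; have ltM : (N.-1 < N)%N by rewrite prednK.
have := christoffel_darboux z ltM; rewrite prednK // -/(cd_kernel z) => ->.
(* The factor [A N.-1] disappears by the convention that it is 1. *)
by rewrite Pz scale0r subr0 /ext_offdiag prednK // eqxx scale1r.
Qed.

Lemma cjacobi_root_real z : root (P N) z -> z = (complex.Re z)%:C.
Proof.
move=> Pz; have := congr1 (horner^~ z^*%C) (christoffel_darboux_root Pz).
rewrite hornerM hornerZ !hornerE (horner_cjacobi_conj N) (rootP Pz) conjc0 mulr0.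
move/eqP; rewrite mulf_eq0 [X in _ || X]gt_eqF ?cd_kernel_conj_gt0 // orbF.
rewrite subr_eq0 => /eqP; case: z {Pz} => x y /= [] /eqP.
by rewrite eq_sym -addr_eq0 -mulr2n mulrn_eq0 /= => /eqP ->.
Qed.

Lemma cjacobi_root_simple z : root (P N) z -> (P N)^`().[z] != 0.
Proof.
move=> Pz; have zR := cjacobi_root_real Pz; apply/eqP => dPz.
have := congr1 (fun q => q^`().[z]) (christoffel_darboux_root Pz).
rewrite derivZ derivM derivXsubC mul1r hornerD hornerM hornerZ dPz mulr0.
rewrite hornerXsubC subrr mul0r addr0 zR => /eqP.
by rewrite gt_eqF ?cd_kernel_real_gt0.
Qed.

Lemma cd_kernel_orthogonal y z : root (P N) y -> root (P N) z -> y != z ->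
  (cd_kernel z).[y] = 0.
Proof.
move=> Py Pz nyz; have := congr1 (horner^~ y) (christoffel_darboux_root Pz).
rewrite hornerM hornerZ hornerXsubC (rootP Py) mulr0 => /eqP.
by rewrite mulf_eq0 subr_eq0 (negPf nyz) => /eqP.
Qed.

Lemma size_cjacobi_poly n : (n <= N)%N -> size (P n) = n.+1.
Proof.
elim: n => [|n IH] nN; first by rewrite cjacobi_poly0 size_poly1.
have An : (A n)%:C != 0 by rewrite fmorph_eq0 A_neq0.
rewrite -(size_scale _ An) cjacobi_poly_rec //.
have sM : size (('X - (b n)%:C%:P) * P n) = n.+2.
  have sPn := IH (ltnW nN).
  have Pn0 : P n != 0 by rewrite -size_poly_gt0 sPn.
  by rewrite size_monicM ?monicXsubC // size_XsubC sPn.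
(* The subtracted term has smaller degree, so it cannot cancel the leading coefficient. *)
rewrite size_polyDl // sM size_polyN; case: n {IH sM An} nN => [|n] nN.
  by rewrite size_poly0.
rewrite (leq_ltn_trans (size_scale_leq _ _)) //.
by rewrite /cjacobi_poly size_map_poly (leq_ltn_trans (size_jacobi_poly _ _ _ _)).
Qed.

Lemma cjacobi_poly_roots : exists2 x : 'I_N -> R,
  injective x & forall k, root (P N) (x k)%:C.
Proof.
have sP := size_cjacobi_poly (leqnn N).
have P0 : P N != 0 by rewrite -size_poly_gt0 sP.
have [rs Prs] := closed_field_poly_normal (P N).
have lP0 : lead_coef (P N) != 0 by rewrite lead_coef_eq0.
have Prsr z : z \in rs -> root (P N) z.
  by rewrite -root_prod_XsubC Prs rootZ.
have srs : size rs = N.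
  by apply/eqP; rewrite -eqSS -sP Prs size_scale // size_prod_XsubC.
have urs : uniq rs.
  rewrite -separable_prod_XsubC.
  have -> : separable_poly (\prod_(z <- rs) ('X - z%:P)) = separable_poly (P N).
    by apply: eqp_separable; rewrite [P N]Prs eqp_sym eqp_scale.
  (* Over a closed field, separability means that [P N] and its derivative have no common root. *)
  rewrite unlock; apply/Pdiv.ClosedField.coprimepP => z Pz.
  exact: cjacobi_root_simple.
have rsk (k : 'I_N) : nth 0 rs k \in rs by rewrite mem_nth ?srs.
have rskR k := cjacobi_root_real (Prsr _ (rsk k)).
exists (fun k => complex.Re (nth 0 rs k)) => [j k jk|k]; last first.
  by rewrite -rskR Prsr.
apply/val_inj/eqP; rewrite -(nth_uniq 0 _ _ urs) ?srs ?ltn_ord //.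
by rewrite rskR jk -rskR.
Qed.

(** * The zeros of [P N] as eigenvalues of the Jacobi matrix *)

Lemma jacobi_eigenvector z : root (P N) z ->
  \row_(n < N) (P n).[z] *m map_mx (real_complex R) (jacobi_mx N a b) =
  z *: \row_(n < N) (P n).[z].
Proof.
move=> Pz; apply/rowP => j; rewrite !mxE.
have rec n : (n < N)%N -> z * (P n).[z] = (b n)%:C * (P n).[z] +
    (A n)%:C * (P n.+1).[z]  + (if n is k.+1 then (A k)%:C * (P k).[z] else 0).
  move=> nN; rewrite -[(A n)%:C * _]hornerZ cjacobi_poly_rec // hornerD hornerN hornerM.
  rewrite hornerXsubC; case: n nN => [|n] nN; rewrite ?horner0 ?hornerZ; ring.
rewrite rec //.
(* Column [j] is split along the three diagonals, to be matched with the three terms of the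
   recurrence. *)
rewrite (eq_bigr (fun i : 'I_N => (if i == j :> nat then (P i).[z] * (b i)%:C else 0)
  + (if i == j.+1 :> nat then (P i).[z] * (a j)%:C else 0)
  + (if j == i.+1 :> nat then (P i).[z] * (a i)%:C else 0))); last first.
  move=> i _; rewrite !mxE -val_eqE /=.
  case: eqP => [->|_]; first by rewrite (ltn_eqF (ltnSn j)) !addr0.
  case: eqP => [->|_]; first by rewrite (ltn_eqF (leqnSn i.+1)) !add0r.
  by case: eqP => _; rewrite ?mulr0 !addr0 ?add0r.
rewrite !big_split /=; congr (_ + _ + _).
- by rewrite -big_mkcond (big_ord1_eq _ (fun i => (P i).[z] * (b i)%:C)) ltn_ord mulrC.
- rewrite -big_mkcond (big_ord1_eq _ (fun i => (P i).[z] * (a j)%:C)).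
  rewrite /ext_offdiag; case: (ltngtP j.+1 N) (ltn_ord j) => // jN _.
    by rewrite mulrC.
  (* The last column has no entry to match [A N.-1] times [P N] at [z], which vanishes as [z] is a
     root. *)
  by rewrite jN (rootP Pz) mulr0.
rewrite -big_mkcond; case: j => [[|j]] jN /=; first by rewrite big_pred0.
under eq_bigl do rewrite eqSS eq_sym.
rewrite (big_ord1_eq _ (fun i => (P i).[z] * (a i)%:C)) ltnW //.
by rewrite /ext_offdiag ltn_eqF // mulrC.
Qed.

(** The [N] distinct nodes are eigenvalues; one more would give the characteristic polynomial, of
    degree [N], [N.+1] distinct roots. *)
Lemma eigenvalue_jacobi (x : 'I_N -> R) z :
    injective x -> (forall k, root (P N) (x k)%:C) ->
  eigenvalue (map_mx (real_complex R) (jacobi_mx N a b)) z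
  <-> exists k, z = (x k)%:C.
Proof.
move=> x_inj Px; set J := map_mx _ _.
have eigx k : eigenvalue J (x k)%:C.
  apply/eigenvalueP; exists (\row_(n < N) (P n).[(x k)%:C]).
    exact: jacobi_eigenvector.
  apply/eqP => /rowP/(_ (Ordinal N_gt0)) /eqP.
  by rewrite !mxE cjacobi_poly0 hornerC oner_eq0.
split=> [|[k ->]//]; rewrite eigenvalue_root_char => Jz.
have [/mapP[k _ ->]|nz] := boolP (z \in [seq (x k)%:C | k <- enum 'I_N]).
  by exists k.
have rootsJ : all (root (char_poly J)) [seq (x k)%:C | k <- enum 'I_N].
  by apply/allP => _ /mapP[k _ ->]; rewrite -eigenvalue_root_char.
have := @max_poly_roots _ (char_poly J) (z :: [seq (x k)%:C | k <- enum 'I_N]).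
rewrite /= size_char_poly size_map size_enum_ord ltnn -size_poly_gt0.
rewrite size_char_poly Jz rootsJ nz map_inj_uniq ?enum_uniq; last first.
  by move=> j k /(fmorph_inj (real_complex R))/x_inj.
by move=> /(_ isT isT isT).
Qed.

(** * Christoffel numbers and dual orthogonality *)

Section Nodes.
Variable x : 'I_N -> R.
Hypotheses (x_inj : injective x) (Px : forall k, root (P N) (x k)%:C).

(** The weight 1 / K_k(x_k), written with the real polynomials [p n] so that it is a real number. *)
Definition christoffel_number (k : 'I_N) : R :=
  (\sum_(n < N) (p n).[x k] ^+ 2)^-1.

Lemma christoffel_numberV k :
  ((christoffel_number k)^-1)%:C = (cd_kernel (x k)%:C).[(x k)%:C].
Proof.
rewrite invrK horner_cd_kernel rmorph_sum; apply: eq_bigr => n _.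
by rewrite horner_cjacobi_real rmorphXn.
Qed.

Lemma christoffel_number_gt0 k : 0 < christoffel_number k.
Proof.
by rewrite -invr_gt0 -ltcR christoffel_numberV cd_kernel_real_gt0.
Qed.

Lemma cd_kernel_nodes j k :
  (cd_kernel (x k)%:C).[(x j)%:C] =
  ((christoffel_number k)^-1)%:C *+ (j == k).
Proof.
have [->|njk] := eqVneq; first by rewrite christoffel_numberV.
by rewrite cd_kernel_orthogonal // (inj_eq (fmorph_inj (real_complex R))) (inj_eq x_inj).
Qed.

(* The vectors [(P n).[x k]]_n are pairwise orthogonal for distinct nodes; a
   one-sided inverse of a square matrix being two-sided, so are the rows. *)
Lemma dual_orthogonality (m n : 'I_N) :
  \sum_k (christoffel_number k)%:C * ((P m).[(x k)%:C] * (P n).[(x k)%:C])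
  = (m == n)%:R.
Proof.
pose V := \matrix_(n < N, k < N) (P n).[(x k)%:C].
pose W := \matrix_(k < N, n < N) ((christoffel_number k)%:C * (P n).[(x k)%:C]).
have /mulmx1C/matrixP/(_ m n) : W *m V = 1%:M.
  apply/matrixP => k j; rewrite !mxE.
  under eq_bigr do rewrite !mxE -mulrA.
  rewrite -mulr_sumr -horner_cd_kernel cd_kernel_nodes eq_sym.
  case: eqVneq => _; last by rewrite mulr0n mulr0.
  by rewrite mulr1n -rmorphM /= divff ?gt_eqF ?christoffel_number_gt0.
rewrite !mxE => <-; apply: eq_bigr => k _; rewrite !mxE; ring.
Qed.

End Nodes.

(** * Uniqueness of the spectral functional and its realization by a quadrature *)

Lemma cjacobi_expansion m (q : {poly R[i]}) :
    (m <= N.+1)%N -> (size q <= m)%N ->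
  exists c : 'I_m -> R[i], q = \sum_(n < m) c n *: P n.
Proof.
elim: m q => [|m IH] q mN qm.
  by exists (fun=> 0); rewrite big_ord0; apply/eqP; rewrite -size_poly_leq0.
have sPm := size_cjacobi_poly mN.
have lP0 : (P m)`_m != 0.
  by rewrite -[m in _`_m]/(m.+1.-1) -sPm lead_coef_eq0 -size_poly_gt0 sPm.
(* Subtracting [d *: P m] kills the coefficient of degree [m], so that the induction hypothesis
   applies. *)
set d := q`_m / (P m)`_m.
have [|c qc] := IH (q - d *: P m) (ltnW mN).
  apply/leq_sizeP => i; rewrite leq_eqVlt => /predU1P[<-|im].
    by rewrite coefB coefZ divfK // subrr.
  by rewrite coefB coefZ !nth_default ?sPm ?mulr0 ?subr0 // (leq_trans qm).
exists (fun n : 'I_m.+1 => oapp c d (unlift ord_max n)).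
rewrite big_ord_recr /= unlift_none /= -[LHS](subrK (d *: P m)) qc.
congr (_ + _); apply: eq_bigr => n _.
have -> : widen_ord (leqnSn m) n = lift ord_max n.
  by apply: val_inj; rewrite [RHS]lift_max.
by rewrite liftK.
Qed.

(* Divide by [P N]: the remainder expands in the [P m * P 0] with [m < N], the
   quotient in the [P m] with [m <= N]. *)
Lemma generalized_spectral_function_unique
    (Omega Omega' : {scalar {poly_(2 * N).+1 R[i]}}) :
    is_generalized_spectral_function a b Omega ->
    is_generalized_spectral_function a b Omega' ->
  Omega =1 Omega'.
Proof.
move=> [O1 O2] [O1' O2'] G.
have sP := size_cjacobi_poly (leqnn N).
have PN0 : P N != 0 by rewrite -size_poly_gt0 sP.
have [c qc] : exists c : 'I_N.+1 -> R[i],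
    (G : {poly R[i]}) %/ P N = \sum_(n < N.+1) c n *: P n.
  (* The quotient has degree at most 2N - N = N. *)
  apply: cjacobi_expansion => //; rewrite size_divp // sP leq_subLR addnS addnn -mul2n.
  exact: size_npoly.
have [d rd] : exists d : 'I_N -> R[i],
    (G : {poly R[i]}) %% P N = \sum_(n < N) d n *: P n.
  apply: cjacobi_expansion; first exact: leqnSn.
  by rewrite -ltnS -sP ltn_modp.
have -> : G = \sum_(m < N.+1) c m *: npolyp (2 * N).+1 (P m * P N) +
              \sum_(m < N) d m *: npolyp (2 * N).+1 (P m * P 0%N).
  apply: val_inj; rewrite /= !raddf_sum /= [LHS](divp_eq _ (P N)) qc rd mulr_suml.
  congr (_ + _); apply: eq_bigr => m _; rewrite -?scalerAl; congr (_ *: _).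
    by rewrite npolypK // size_cjacobi_polyM // -ltnS.
  by rewrite npolypK ?size_cjacobi_polyM ?(ltnW (ltn_ord m)) // cjacobi_poly0 mulr1.
rewrite !raddfD !raddf_sum /=; congr (_ + _); apply: eq_bigr => m _.
  by rewrite !linearZ /= O2 ?O2' // -ltnS.
by rewrite !linearZ /= O1 ?O1'.
Qed.

Lemma quadrature_spectral (x : 'I_N -> R) :
    injective x -> (forall k, root (P N) (x k)%:C) ->
  is_generalized_spectral_function (N := N) a b
    (quadrature (fun k => (christoffel_number x k)%:C) (fun k => (x k)%:C)).
Proof.
move=> x_inj Px; split=> [m n mN nN|m mN].
  rewrite -(dual_orthogonality x_inj Px (Ordinal mN) (Ordinal nN)).
  apply: eq_bigr => k _; rewrite npolypK ?size_cjacobi_polyM ?(ltnW mN, ltnW nN) //.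
  by rewrite hornerM.
apply: big1 => k _; rewrite npolypK ?size_cjacobi_polyM //.
by rewrite hornerM (rootP (Px k)) !mulr0.
Qed.

End ChristoffelDarboux.

Theorem theorem9 (R : realType) (N : nat) (a b : nat -> R)
    (N_gt0 : (0 < N)%N) (a_neq0 : forall n, (n.+1 < N)%N -> a n != 0) :
  exists lambda : 'I_N -> R,
    [/\ injective lambda,
        forall z : R[i],
          eigenvalue (map_mx (real_complex R) (jacobi_mx N a b)) z
          <-> exists k, z = (lambda k)%:C
      & exists! beta : {ffun 'I_N -> R},
          (forall k, 0 < beta k) /\
          forall Omega : {scalar {poly_(2 * N).+1 R[i]}},
            is_generalized_spectral_function a b Omega ->
            forall G : {poly_(2 * N).+1 R[i]},
              Omega G = \sum_(k < N)
                (beta k)%:C * (G : {poly R[i]}).[(lambda k)%:C]].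
Proof.
have [x x_inj Px] := cjacobi_poly_roots b a_neq0 N_gt0.
(* This also provides a spectral functional, without which the condition on [beta] would be
   vacuous. *)
have qs := quadrature_spectral a_neq0 N_gt0 x_inj Px.
exists x; split=> // [z|]; first exact: eigenvalue_jacobi.
exists [ffun k => christoffel_number a b x k]; split=> [|beta [_ betaP]].
  split=> [k|Omega OmegaP G]; first by rewrite ffunE christoffel_number_gt0.
  rewrite (generalized_spectral_function_unique a_neq0 N_gt0 OmegaP qs).
  by apply: eq_bigr => k _; rewrite ffunE.
apply/ffunP => k; rewrite ffunE.
set w := christoffel_number a b x k.
have w_gt0 : 0 < w by apply: christoffel_number_gt0.
(* The kernel at [x k] vanishes at every other node and equals [w^-1] at [x k], so it isolates the
   weight of index [k]. *)
pose G := npolyp (2 * N).+1 (cd_kernel N a b (x k)%:C).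
have GE : (G : {poly R[i]}) = cd_kernel N a b (x k)%:C.
  apply: npolypK; apply: leq_trans (size_sum _ _ _) _.
  apply/bigmax_leqP => n _; apply: leq_trans (size_scale_leq _ _) _.
  rewrite (size_cjacobi_poly b a_neq0) ?ltnS; last exact: ltnW.
  by rewrite (leq_trans (ltnW (ltn_ord n))) // leq_pmull.
have only_k (g : 'I_N -> R) :
    \sum_j (g j)%:C * (G : {poly R[i]}).[(x j)%:C] = (g k * w^-1)%:C.
  rewrite (bigD1 k) //= big1 ?addr0 => [|j njk]; rewrite GE cd_kernel_nodes //.
    by rewrite eqxx mulr1n rmorphM.
  by rewrite (negPf njk) mulr0.
have := betaP _ qs G; rewrite [LHS]only_k only_k.
have w0 : w^-1 != 0 by rewrite invr_eq0 gt_eqF.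
by move=> /(fmorph_inj (real_complex R)) /(mulIf w0).
Qed.
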